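(* Consider an arbitrary (multichain) average-reward MDP $(\mathcal{S},\mathcal{A},P,r)$ with finite $\mathcal{S},\mathcal{A}$, let $\alpha\in(0,1/|\mathcal{A}|)$, $\mu\in\mathcal{M}_+(\mathcal{S})$ and $\pi_0\in\Pi_\alpha$. Then the $\alpha$-clipped policy mirror ascent started at $\pi_0$ with step sizes satisfying $(C_\alpha-1)\eta_{k+1}\ge C_\alpha\eta_k>0$ for all $k$ generates a sequence of policies $\{\pi_k\}$ satisfying, for every $k$, $$J_\mu^{\pi_\alpha}-J_\mu^{\pi_k}\le\Big(1-\frac{1}{C_\alpha}\Big)^{k}\left(\frac{D_{\rho_\mu^{\pi_\alpha}}(\pi_\alpha,\pi_0)}{\eta_0(C_\alpha-1)}+J_\mu^{\pi_\alpha}-J_\mu^{\pi_0}\right),$$ where $\pi_\alpha\in\arg\max_{\pi\in\Pi_\alpha}J_\mu^\pi$.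
   Context: MDP. $(\mathcal{S},\mathcal{A},P,r)$ has finite state space $\mathcal{S}$, finite action space $\mathcal{A}$, transition kernel $P:\mathcal{S}\times\mathcal{A}\to\mathcal{M}(\mathcal{S})$ and reward $r:\mathcal{S}\times\mathcal{A}\to[-R,R]$; $\mathcal{M}(X)$ is the set of probability distributions on $X$ and $\mathcal{M}_+(X)$ those with full support. ''Multichain'' means general: no structural assumption. A policy is $\pi:\mathcal{S}\to\mathcal{M}(\mathcal{A})$; $\Pi$ is the set of all policies, $\Pi_+=\{\pi\in\Pi:\pi(a\mid s)>0\ \forall s,a\}$, $\Pi_\alpha=\{\pi\in\Pi:\pi(a\mid s)\ge\alpha\ \forall s,a\}$, $\mathcal{M}_\alpha(\mathcal{A})=\{p\in\mathcal{M}(\mathcal{A}):p(a)\ge\alpha\ \forall a\}$. For a policy $\pi$: $r^\pi(s)=\sum_a\pi(a\mid s)r(s,a)$, $P^\pi(s,s')=\sum_a\pi(a\mid s)P(s'\mid s,a)$, $P^\pi_\star=\lim_{H\to\infty}\frac1H\sum_{i=0}^{H-1}(P^\pi)^i$ (exists), $(Pf)(s,a)=\sum_{s'}P(s'\mid s,a)f(s')$. Values. Average reward $J^\pi(s)=\liminf_{H\to\infty}\frac1H\mathbb{E}_\pi[\sum_{h=0}^{H-1}r(s_h,a_h)\mid s_0=s]$, i.e. $J^\pi=P^\pi_\star r^\pi$; $J^\pi_\mu=\sum_s\mu(s)J^\pi(s)$; $V^\pi=(I-P^\pi+P^\pi_\star)^{-1}(I-P^\pi_\star)r^\pi$, $K^\pi=PJ^\pi$,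 $Q^\pi=r+PV^\pi-K^\pi$. State classification. A state is recurrent under $\pi$ if the chain $P^\pi$ started there returns with probability $1$, transient otherwise. The decomposition of $\mathcal{S}$ into transient states $\mathcal{T}$ and recurrent classes $\mathcal{R}_1,\dots,\mathcal{R}_m$ is the same for all $\pi\in\Pi_+$; $\mathcal{T}$ and $\mathcal{R}=\bigcup_i\mathcal{R}_i$ denote these fixed sets. Visitation measures. For $\pi\in\Pi_+$: $d^\pi_\mu(s)=\sum_{s_0}\mu(s_0)P^\pi_\star(s_0,s)$; $\bar T^\pi(s_1,s_2)=P^\pi(s_1,s_2)$ if $s_1,s_2\in\mathcal{T}$, else $0$; $\delta^\pi_\mu(s)=\sum_{s_0}\mu(s_0)\big((I-\bar T^\pi)^{-1}\big)(s_0,s)$; $\rho^\pi_\mu(s)=d^\pi_\mu(s)\mathbf{1}_{\mathcal{R}}(s)+\delta^\pi_\mu(s)\mathbf{1}_{\mathcal{T}}(s)$. Set $C_\alpha=\max_{s\in\mathcal{S},\,\pi,\pi'\in\Pi_\alpha}\rho^\pi_\mu(s)/\rho^{\pi'}_\mu(s)$, which is finite. The maximizer $\pi_\alpha$ exists. Bregman divergence. $h:\mathcal{M}(\mathcal{A})\to\mathbb{R}$ is strictly convex and continuously differentiable on the relative interior of $\mathcal{M}(\mathcal{A})$; $D(p,p')=h(p)-h(p')-\langle\nabla h(p'),p-p'\rangle$ for $p\in\mathcal{M}(\mathcal{A})$ and $p'$ in the relative interior. For $\rho\in\mathbb{R}_+^{|\mathcal{S}|}$, $D_\rho(\pi,\pi')=\sum_s\rho(s)D(\pi(\cdot\mid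 s),\pi'(\cdot\mid s))$. Algorithm ($\alpha$-clipped policy mirror ascent). With $G^\pi(s,a)=Q^\pi(s,a)\mathbf{1}_{\mathcal{R}}(s)+K^\pi(s,a)\mathbf{1}_{\mathcal{T}}(s)$, from $\pi_0\in\Pi_\alpha$ and step sizes $\eta_k>0$, for $k\ge0$ and every $s\in\mathcal{S}$: $$\pi_{k+1}(\cdot\mid s)=\arg\max_{p\in\mathcal{M}_\alpha(\mathcal{A})}\Big\{\eta_k\sum_{a}G^{\pi_k}(s,a)p(a)-D\big(p,\pi_k(\cdot\mid s)\big)\Big\}.$$ *)

(* Defs.v *)
(* MathComp-Analysis, over an arbitrary R : realType. *)
From HB Require Import structures.
From mathcomp Require Import all_boot all_order all_algebra.
From mathcomp Require Import all_classical all_reals all_analysis.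

Set Implicit Arguments.
Unset Strict Implicit.
Unset Printing Implicit Defensive.

Import Order.TTheory GRing.Theory Num.Theory.
Import numFieldNormedType.Exports.

Local Open Scope classical_set_scope.
Local Open Scope ring_scope.

(* The state space is 'I_n and the action space 'I_m.  A distribution is a row
   vector, a function of the state a column vector (except that rewards and
   other functions of a state-action pair are 'M_(n, m) or curried), and a
   policy an 'M_(n, m) whose row s is pi(. | s). *)

Section Convexity.
Context {R : realType}.

Definition affine_hull (V : lmodType R) (C : set V) : set V :=
  [set x | exists (k : nat) (c : 'I_k -> R) (y : 'I_k -> V),
     [/\ forall i, C (y i), \sum_i c i = 1 & x = \sum_i c i *: y i]].

Definition relint (V : normedModType R) (C : set V) : set V :=
  [set x | C x /\ \forall y \near within (affine_hull C) (nbhs x), C y].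

Definition strictly_convex_on (V : lmodType R) (C : set V) (f : V -> R) :=
  forall (x y : V) (t : R), C x -> C y -> x != y -> 0 < t < 1 ->
    f (t *: x + (1 - t) *: y) < t * f x + (1 - t) * f y.

Definition dotv k (u v : 'rV[R]_k) : R := \sum_i u 0 i * v 0 i.

(* g is a gradient of h on the relative interior of C, where h is seen as a
   function on C only: the first-order expansion is required along C.  This
   determines g only up to a vector normal to the affine hull of C. *)
Definition is_gradient k (C : set 'rV[R]_k)
    (h : 'rV[R]_k -> R) (g : 'rV[R]_k -> 'rV[R]_k) :=
  forall p, relint C p -> forall e : R, 0 < e ->
    \forall q \near within C (nbhs p),
      `|h q - h p - dotv (g p) (q - p)| <= e * `|q - p|.

Definition C1_on_relint k (C : set 'rV[R]_k)
    (h : 'rV[R]_k -> R) (g : 'rV[R]_k -> 'rV[R]_k) :=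
  is_gradient C h g /\ {within relint C, continuous g}.

Definition argmax (T : Type) (C : set T) (f : T -> R) : set T :=
  [set x | C x /\ forall y, C y -> f y <= f x].

Definition distr k : set 'rV[R]_k :=
  [set p | (forall i, 0 <= p 0 i) /\ \sum_i p 0 i = 1].

Definition distr_pos k : set 'rV[R]_k :=
  [set p | distr p /\ forall i, 0 < p 0 i].

Definition distr_ge (alpha : R) k : set 'rV[R]_k :=
  [set p | distr p /\ forall i, alpha <= p 0 i].

(* Only the values of h on distributions matter; g stands for its gradient. *)
Definition bregman k (h : 'rV[R]_k -> R) (g : 'rV[R]_k -> 'rV[R]_k)
    (p p' : 'rV[R]_k) : R :=
  h p - h p' - dotv (g p') (p - p').

Definition bregman_weighted n m (h : 'rV[R]_m -> R) (g : 'rV[R]_m -> 'rV[R]_m)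
    (rho : 'rV[R]_n) (pi pi' : 'M[R]_(n, m)) : R :=
  \sum_s rho 0 s * bregman h g (row s pi) (row s pi').

End Convexity.

Section MarkovChain.
Context {R : realType} {n : nat}.
Implicit Type P : 'M[R]_n.

Definition cesaro_limit P : 'M[R]_n :=
  \matrix_(i, j) limn (fun H : nat => H%:R^-1 * \sum_(k < H) (P ^+ k) i j).

(* P with the entries into s removed *)
Definition taboo P (s : 'I_n) : 'M[R]_n :=
  \matrix_(i, j) if j == s then 0 else P i j.

(* probability that the chain started at s first returns to s at time k + 1 *)
Definition first_return P (s : 'I_n) (k : nat) : R :=
  (taboo P s ^+ k *m P) s s.

Definition recurrent_state P (s : 'I_n) : Prop :=
  series (first_return P s) @ \oo --> (1 : R).

End MarkovChain.

Record mdp (R : realType) (n m : nat) := MDP {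
  trans : 'I_n -> 'I_m -> 'rV[R]_n;
  reward : 'M[R]_(n, m);
  reward_bound : R;
  trans_distr : forall s a, distr (trans s a);
  reward_bounded :
    forall s a, - reward_bound <= reward s a <= reward_bound
}.

Section MDP.
Context {R : realType} {n m : nat}.
Variable M : mdp R n m.
Implicit Types (pi : 'M[R]_(n, m)) (mu : 'rV[R]_n).

Definition policy : set 'M[R]_(n, m) :=
  [set pi | forall s, distr (row s pi)].

Definition policy_pos : set 'M[R]_(n, m) :=
  [set pi | policy pi /\ forall s a, 0 < pi s a].

Definition policy_ge (alpha : R) : set 'M[R]_(n, m) :=
  [set pi | policy pi /\ forall s a, alpha <= pi s a].

Definition Ppol pi : 'M[R]_n :=
  \matrix_(s, s') \sum_a pi s a * trans M s a 0 s'.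

Definition rpol pi : 'cV[R]_n := \col_s \sum_a pi s a * reward M s a.

Definition Pstar pi : 'M[R]_n := cesaro_limit (Ppol pi).

(* probability of the trajectory s_0, a_0, s_1, a_1, ... when s_0 has law nu *)
Fixpoint traj_prob pi (nu : 'rV[R]_n) (tau : seq ('I_n * 'I_m)) : R :=
  if tau is (s, a) :: tau' then
    nu 0 s * pi s a * traj_prob pi (trans M s a) tau'
  else 1.

Definition expected_return pi (s : 'I_n) (H : nat) : R :=
  \sum_(tau : H.-tuple ('I_n * 'I_m))
    traj_prob pi (delta_mx 0 s) tau * \sum_(x <- tau) reward M x.1 x.2.

Definition J pi : 'cV[R]_n :=
  \col_s limn_inf (fun H : nat => H%:R^-1 * expected_return pi s H).

Definition Jmu mu pi : R := \sum_s mu 0 s * J pi s 0.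

Definition V pi : 'cV[R]_n :=
  invmx (1%:M - Ppol pi + Pstar pi) *m (1%:M - Pstar pi) *m rpol pi.

Definition Pf (f : 'cV[R]_n) : 'M[R]_(n, m) :=
  \matrix_(s, a) \sum_s' trans M s a 0 s' * f s' 0.

Definition K pi : 'M[R]_(n, m) := Pf (J pi).

Definition Q pi : 'M[R]_(n, m) := reward M + Pf (V pi) - K pi.

(* The classification of states is the same for all pi in policy_pos (which is
   nonempty when 0 < m), so quantifying over all of them only names it. *)
Definition rec_states : {set 'I_n} :=
  [set s | `[< forall pi, policy_pos pi -> recurrent_state (Ppol pi) s >]].

Definition trans_states : {set 'I_n} := ~: rec_states.

Definition d_visit mu pi : 'rV[R]_n := mu *m Pstar pi.

Definition Tbar pi : 'M[R]_n :=
  \matrix_(s1, s2)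
    if (s1 \in trans_states) && (s2 \in trans_states) then Ppol pi s1 s2 else 0.

Definition delta_visit mu pi : 'rV[R]_n := mu *m invmx (1%:M - Tbar pi).

Definition rho mu pi : 'rV[R]_n :=
  \row_s (d_visit mu pi 0 s * (s \in rec_states)%:R
          + delta_visit mu pi 0 s * (s \in trans_states)%:R).

(* The maximum over policy_ge alpha, written as a supremum in R. *)
Definition Calpha (alpha : R) mu : R :=
  sup [set x : R | exists s pi pi', [/\ policy_ge alpha pi, policy_ge alpha pi'
                                      & x = rho mu pi 0 s / rho mu pi' 0 s]].

Definition G pi : 'M[R]_(n, m) :=
  \matrix_(s, a) (Q pi s a * (s \in rec_states)%:R
                  + K pi s a * (s \in trans_states)%:R).

Definition clipped_mirror_ascent (h : 'rV[R]_m -> R)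
    (g : 'rV[R]_m -> 'rV[R]_m) (alpha : R) (eta : nat -> R)
    (pi0 : 'M[R]_(n, m)) (pi : nat -> 'M[R]_(n, m)) : Prop :=
  pi 0%N = pi0 /\
  forall (k : nat) (s : 'I_n),
    argmax (distr_ge alpha (k := m))
      (fun p => eta k * (\sum_a G (pi k) s a * p 0 a)
                - bregman h g p (row s (pi k)))
      (row s (pi k.+1)).

End MDP.

(* Main.v *)
Require Import Defs.
From HB Require Import structures.
From mathcomp Require Import all_boot all_order all_algebra.
From mathcomp Require Import all_classical all_reals all_analysis.
From mathcomp Require Import ring lra zify.

Import Order.TTheory GRing.Theory Num.Theory.
Import numFieldNormedType.Exports.

Local Open Scope classical_set_scope.
Local Open Scope ring_scope.

(** The argument combines an exact first-order expansion of the average reward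
    with the contraction argument for mirror ascent.

    Markov chains.  For a stochastic [P], [ker (1 - P)] meets the image of
    [1 - P] trivially, because the powers of [P] are bounded.  Hence
    [1 - P = Y (1 - P)^2] for some [Y], and the averages of the powers of [P]
    converge to [E = 1 - Y (1 - P)], the projection onto the stationary rows
    ([cesaro_spec]).  A state is called essential when it can be reached back
    from every state it reaches; this depends on the support of [P] only, and
    it characterizes both recurrence ([recurrent_essential]) and the states
    charged by [E] ([cesaro_essential], [essential_cesaro]).  So all policies
    with full support share their recurrent states, on which the average reward
    [J] is constant along transitions ([harmonic_const]).

    Performance difference.  For two such policies,
    [Jmu pi' - Jmu pi = sum_s rho' s * sum_a G^pi s a * (pi' s a - pi s a)].
    On recurrent states this is the Poisson equation of [pi] averaged under the
    stationary law of [pi'].  On transient states, [Pstar' J - J] vanishes at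
    the recurrent states and solves a linear system for the chain of [pi']
    killed there, whose resolvent [(1 - Tbar')^-1] appears in [rho'].

    Contraction.  Optimality of [pi k.+1] gives at each state the three-point
    inequality of the divergence ([three_point]).  Taking [pi k] as comparator
    shows that each state improves; taking [pi_alpha], with weights [rho] of
    [pi_alpha], bounds the gap [d k = Jmu pi_alpha - Jmu (pi k)] by a decrease
    of the weighted divergence [B k] plus the improvement weighted by the wrong
    measure.  Each summand of the latter is nonnegative, so changing the measure
    costs a factor [C = Calpha] and leaves [C (d k - d k.+1)].  This gives
    [C d k.+1 + B k.+1 / eta k <= (C - 1) d k + B k / eta k],
    and the growth of the step sizes turns it into a contraction by [1 - 1/C]
    of [d k + B k / (eta k (C - 1))]. *)

(** * Stochastic matrices *)

Section Stochastic.
Context {R : realType} {n : nat}.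
Implicit Types (P : 'M[R]_n) (u : 'rV[R]_n) (x : 'cV[R]_n) (s t i j : 'I_n).

Definition stochastic P := forall i, distr (row i P).

Lemma stochastic_ge0 P i j : stochastic P -> 0 <= P i j.
Proof. by move=> /(_ i)[+ _] => /(_ j); rewrite mxE. Qed.

Lemma stochastic_sum1 P i : stochastic P -> \sum_j P i j = 1.
Proof. by move=> /(_ i)[_ <-]; apply: eq_bigr => j _; rewrite mxE. Qed.

Lemma stochastic_mul1 P :
  stochastic P -> P *m const_mx 1 = const_mx 1 :> 'cV[R]_n.
Proof.
move=> Ps; apply/matrixP => i j; rewrite !mxE -[RHS](stochastic_sum1 P i Ps).
by apply: eq_bigr => k _; rewrite mxE mulr1.
Qed.

Lemma stochastic_le1 P i j : stochastic P -> P i j <= 1.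
Proof.
move=> Ps; rewrite -(stochastic_sum1 P i Ps) (bigD1 j) //= lerDl.
by apply: sumr_ge0 => k _; exact: stochastic_ge0.
Qed.

Lemma stochasticP P :
  (forall i j, 0 <= P i j) -> P *m const_mx 1 = const_mx 1 :> 'cV[R]_n ->
  stochastic P.
Proof.
move=> P0 P1 i; split=> [j|]; first by rewrite mxE.
have /matrixP/(_ i 0) := P1; rewrite !mxE => <-.
by apply: eq_bigr => k _; rewrite !mxE mulr1.
Qed.

Lemma mulmx_ge0 p q r (A : 'M[R]_(p, q)) (B : 'M[R]_(q, r)) :
  (forall a b, 0 <= A a b) -> (forall b c, 0 <= B b c) ->
  forall a c, 0 <= (A *m B) a c.
Proof.
by move=> A0 B0 a c; rewrite mxE; apply: sumr_ge0 => b _; exact: mulr_ge0.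
Qed.

Lemma sumr_gt0_term (I : finType) (F : I -> R) (a : I) :
  (forall b, 0 <= F b) -> 0 < F a -> 0 < \sum_b F b.
Proof.
by move=> F0 Fa; rewrite (bigD1 a) //= ltr_wpDr // sumr_ge0.
Qed.

Lemma stochasticX P k : stochastic P -> stochastic (P ^+ k).
Proof.
move=> Ps; elim: k => [|k IHk].
  rewrite expr0; apply: stochasticP; last by rewrite mul1mx.
  by move=> i j; rewrite mxE ler0n.
apply: stochasticP => [|]; rewrite exprS -mulmxE.
  by apply: mulmx_ge0 => i j; exact: stochastic_ge0.
by rewrite -mulmxA stochastic_mul1 // stochastic_mul1.
Qed.

Lemma mulmx_iter_fix P x k : P *m x = x -> P ^+ k *m x = x.
Proof.
by move=> Px; elim: k => [|k IHk]; rewrite ?mul1mx // exprSr -mulmxE -mulmxA Px.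
Qed.

Lemma mulmx_iter_fixl P u k : u *m P = u -> u *m P ^+ k = u.
Proof.
by move=> uP; elim: k => [|k IHk]; rewrite ?mulmx1 // exprS -mulmxE mulmxA uP.
Qed.

(** * The Cesaro limit of a stochastic matrix *)

Lemma telescope_powers P H :
  (1%:M - P) *m (\sum_(k < H) P ^+ k) = 1%:M - P ^+ H.
Proof.
rewrite mulmxE -[RHS]opprB -[X in _ = - (_ - X)]/(1 : 'M[R]_n) subrX1.
by rewrite -mulNr opprB.
Qed.

Lemma norm_row_defect P (p : nat) (A : 'M[R]_(p, n)) (x : 'cV[R]_n) H (a : 'I_p) :
  stochastic P ->
  `|(A *m (1%:M - P ^+ H) *m x) a 0| <= \sum_k \sum_l `|A a l| * 2 * `|x k 0|.
Proof.
move=> Ps; rewrite mxE (le_trans (ler_norm_sum _ _ _)) // ler_sum // => k _.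
rewrite normrM mxE -mulr_suml ler_wpM2r //.
rewrite (le_trans (ler_norm_sum _ _ _)) // ler_sum // => l _.
rewrite normrM ler_wpM2l // !mxE.
have := stochastic_ge0 _ l k (stochasticX P H Ps).
have := stochastic_le1 _ l k (stochasticX P H Ps).
by case: (l == k) => /= ? ?; rewrite ler_norml; lra.
Qed.

(** The row [w = u (1 - P)] is fixed by [P], so [H w] is the sum of the rows
    [w P^k] for [k < H].  That sum telescopes to [u (1 - P^H)], which stays
    bounded in [H]; so [w] is zero. *)
Lemma fixed_defect_eq0 P u : stochastic P ->
  u *m (1%:M - P) *m (1%:M - P) = 0 -> u *m (1%:M - P) = 0.
Proof.
move=> Ps; set w := u *m _ => w0.
have wP : w *m P = w.
  by apply/esym/eqP; rewrite -subr_eq0 -{1}(mulmx1 w) -mulmxBr w0.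
apply/matrixP => i j; rewrite [RHS]mxE; apply/eqP/contraT => wij.
set c := \sum_k \sum_l `|u i l| * 2 * `|(delta_mx j 0 : 'cV[R]_n) k 0|.
have bnd H : H%:R * `|w i j| <= c.
  have <- : `|(u *m (1%:M - P ^+ H) *m (delta_mx j 0 : 'cV[R]_n)) i 0| =
      H%:R * `|w i j|.
    rewrite -telescope_powers mulmxA -/w mulmx_sumr.
    under eq_bigr => k _ do rewrite mulmx_iter_fixl //.
    rewrite sumr_const card_ord -colE mxE mulmxnE.
    by rewrite normrMn mulr_natl.
  exact: norm_row_defect.
have wpos : 0 < `|w i j| by rewrite normr_gt0.
have := bnd (Num.bound (c / `|w i j|)); rewrite -ler_pdivlMr // leNgt.
suff -> : c / `|w i j| < (Num.bound (c / `|w i j|))%:R by [].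
apply: archi_boundP; rewrite divr_ge0 // /c.
by apply: sumr_ge0 => k _; apply: sumr_ge0 => l _; rewrite !mulr_ge0.
Qed.

(** By [fixed_defect_eq0] the kernel of [1 - P] meets its image trivially, so
    [1 - P] and its square have the same rank, hence the same row space. *)
Lemma defect_factor P : stochastic P ->
  exists Y : 'M[R]_n, 1%:M - P = Y *m (1%:M - P) *m (1%:M - P).
Proof.
move=> Ps; set B := 1%:M - P.
have kerB : (kermx (B *m B) <= kermx B)%MS.
  apply/row_subP => i; rewrite sub_kermx; apply/eqP.
  by apply: fixed_defect_eq0 => //; rewrite -mulmxA -row_mul mulmx_ker row0.
have rkB : (\rank B <= \rank (B *m B))%N.
  have := mxrankS kerB; rewrite !mxrank_ker.
  by have := rank_leq_row B; have := rank_leq_row (B *m B); lia.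
have : (B <= B *m B)%MS.
  by rewrite -(geq_leqif (mxrank_leqif_sup (submxMl B B))).
by case/submxP => Y BE; exists Y; rewrite -mulmxA.
Qed.

Lemma average_entry P i j :
  (fun H : nat => H%:R^-1 * \sum_(k < H) (P ^+ k *m delta_mx j (0 : 'I_1)) i 0) =
  (fun H : nat => H%:R^-1 * \sum_(k < H) (P ^+ k) i j).
Proof.
apply/funext => H; congr (_ * _).
by apply: eq_bigr => k _; rewrite -colE mxE.
Qed.

(** The average of the powers below [H] is [E + Y (1 - P^H) / H] for
    [E = 1 - Y (1 - P)], since [E] absorbs [P] and the rest telescopes. *)
Lemma cesaro_spec P : stochastic P -> exists Y : 'M[R]_n,
  [/\ cesaro_limit P = 1%:M - Y *m (1%:M - P),
      1%:M - P = Y *m (1%:M - P) *m (1%:M - P) &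
      forall x i, (fun H : nat => H%:R^-1 * \sum_(k < H) (P ^+ k *m x) i 0)
          @ \oo --> (cesaro_limit P *m x) i 0].
Proof.
move=> Ps; have [Y BE] := defect_factor P Ps; exists Y.
set E := 1%:M - Y *m (1%:M - P).
have EP : E *m P = E.
  apply/esym/eqP; rewrite -subr_eq0 -{1}(mulmx1 E) -mulmxBr /E mulmxBl mul1mx.
  by rewrite -BE subrr.
have cvgE x i : (fun H : nat => H%:R^-1 * \sum_(k < H) (P ^+ k *m x) i 0)
    @ \oo --> (E *m x) i 0.
  set c := \sum_k \sum_l `|Y i l| * 2 * `|x k 0|.
  have c0 : 0 <= c.
    by apply: sumr_ge0 => k _; apply: sumr_ge0 => l _; rewrite !mulr_ge0.
  have avgE H : \sum_(k < H) (P ^+ k *m x) i 0 =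
      (E *m x) i 0 *+ H + (Y *m (1%:M - P ^+ H) *m x) i 0.
    rewrite -summxE -mulmx_suml -mulmxnE.
    transitivity ((E *m x *+ H + Y *m (1%:M - P ^+ H) *m x) i 0); last first.
      by rewrite [LHS]mxE.
    congr (_ i 0); rewrite -telescope_powers mulmxA.
    rewrite -scaler_nat scalemxAl scaler_nat -mulmxDl.
    congr (_ *m x); rewrite -[LHS]mul1mx.
    rewrite -[X in X *m _](subrK (Y *m (1%:M - P))) -/E mulmxDl.
    congr (_ + _); rewrite mulmx_sumr.
    under eq_bigr => k _.
      have -> : E *m P ^+ k = E.
        elim: (nat_of_ord k) => [|l IHl]; first by rewrite expr0 mulmx1.
        by rewrite exprS -mulmxE mulmxA EP.
      over.
    by rewrite sumr_const card_ord.
  apply/cvgrPdist_lep => /=.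
  near=> e; near=> H.
  have H0 : 0 < H%:R :> R by rewrite ltr0n; near: H; exists 1%N.
  rewrite avgE -[(E *m x) i 0 *+ H]mulr_natl mulrDr mulKf ?gt_eqF //.
  rewrite opprD addNKr normrN normrM.
  rewrite ger0_norm ?invr_ge0 ?ler0n // ler_pdivrMl // mulrC.
  rewrite (le_trans (norm_row_defect _ _ _ _ _ _ Ps)) // -/c.
  rewrite -ler_pdivrMl // mulrC; near: H; exact: nbhs_infty_ger.
have EE : cesaro_limit P = E.
  apply/matrixP => i j; rewrite mxE; apply: cvg_lim => //.
  by have := cvgE (delta_mx j 0) i; rewrite average_entry -colE mxE.
by split; rewrite ?EE.
Unshelve. all: end_near.
Qed.

Section CesaroLimit.
Variable P : 'M[R]_n.
Hypothesis Ps : stochastic P.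
Local Notation E := (cesaro_limit P).

Lemma cvg_cesaro x i :
  (fun H : nat => H%:R^-1 * \sum_(k < H) (P ^+ k *m x) i 0)
    @ \oo --> (E *m x) i 0.
Proof. by have [Y [_ _]] := cesaro_spec P Ps. Qed.

Lemma defect_eq0 p (A : 'M[R]_(p, n)) : (A *m (1%:M - P) == 0) = (A *m P == A).
Proof. by rewrite mulmxBr mulmx1 subr_eq0 eq_sym. Qed.

Lemma defect_eq0r p (A : 'M[R]_(n, p)) : ((1%:M - P) *m A == 0) = (P *m A == A).
Proof. by rewrite mulmxBl mul1mx subr_eq0 eq_sym. Qed.

Lemma cesaro_mulr : E *m P = E.
Proof.
have [Y [-> BE _]] := cesaro_spec P Ps.
by apply/eqP; rewrite -defect_eq0 mulmxBl mul1mx -BE subrr.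
Qed.

(** Write [B = 1 - P = Y B^2].  Then [(B - B Y B) B = 0], and the rows of
    [B - B Y B] are in the image of [B], so they vanish by [fixed_defect_eq0];
    that is [B E = 0]. *)
Lemma cesaro_mull : P *m E = E.
Proof.
have [Y [-> BE _]] := cesaro_spec P Ps; apply/eqP; rewrite -defect_eq0r.
set B := 1%:M - P in BE *; set W := 1%:M - B *m Y.
have -> : B *m (1%:M - Y *m B) = W *m B.
  by rewrite mulmxBr [W *m B]mulmxBl mulmx1 mul1mx mulmxA.
apply/eqP/row_matrixP => i; rewrite row0 row_mul.
apply: fixed_defect_eq0 => //; rewrite -mulmxA -row_mul -/B.
suff -> : W *m (B *m B) = 0 by rewrite row0.
by rewrite mulmxBl mul1mx -mulmxA [Y *m _]mulmxA -BE subrr.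
Qed.

Lemma cesaro_fixl u : u *m P = u -> u *m E = u.
Proof.
move=> /eqP; rewrite -defect_eq0 => /eqP uB0.
have [Y [-> BE _]] := cesaro_spec P Ps; rewrite mulmxBr mulmx1.
apply/eqP; rewrite -subr_eq0 addrAC subrr add0r oppr_eq0; apply/eqP.
rewrite mulmxA; apply: (fixed_defect_eq0 P) => //.
by rewrite -!mulmxA [Y *m _]mulmxA -BE.
Qed.

Lemma cesaro_fixr x : P *m x = x -> E *m x = x.
Proof.
move=> /eqP; rewrite -defect_eq0r => /eqP xB0.
have [Y [-> BE _]] := cesaro_spec P Ps.
by rewrite mulmxBl mul1mx -mulmxA xB0 mulmx0 subr0.
Qed.

Lemma cesaro_idem : E *m E = E.
Proof.
apply/row_matrixP => i; rewrite row_mul; apply: cesaro_fixl.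
by rewrite -row_mul cesaro_mulr.
Qed.

Lemma cesaro_entry i j : (fun H : nat => H%:R^-1 * \sum_(k < H) (P ^+ k) i j)
    @ \oo --> E i j.
Proof.
by have := cvg_cesaro (delta_mx j 0) i; rewrite average_entry -colE mxE.
Qed.

Lemma cesaro_ge0 i j : 0 <= E i j.
Proof.
apply: (cvgr_to_ge (cesaro_entry i j)); apply: nearW => H.
rewrite mulr_ge0 ?invr_ge0 // sumr_ge0 // => k _.
exact: stochastic_ge0 (stochasticX P k Ps).
Qed.

Lemma cesaro_stochastic : stochastic E.
Proof.
by apply: stochasticP; [exact: cesaro_ge0|exact/cesaro_fixr/stochastic_mul1].
Qed.

Lemma cesaro_mullX k : E *m P ^+ k = E.
Proof.
elim: k => [|k IHk]; first by rewrite mulmx1.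
by rewrite exprS -mulmxE mulmxA cesaro_mulr.
Qed.

Lemma fundamental_unit : 1%:M - P + E \in unitmx.
Proof.
rewrite -row_free_unit; apply: inj_row_free => u uZ0.
have uE : u *m E = 0.
  have : u *m (1%:M - P + E) *m E = u *m E.
    rewrite -mulmxA mulmxDl mulmxBl mul1mx cesaro_mull subrr add0r.
    by rewrite cesaro_idem.
  by rewrite uZ0 mul0mx.
rewrite -uE; apply/esym/cesaro_fixl/eqP; rewrite -defect_eq0.
by apply/eqP; rewrite -{}uZ0 [RHS]mulmxDr uE addr0.
Qed.

(** Multiplied by [E], the equation [(1 - P + E) V = (1 - E) x] gives
    [E V = 0], so that it reads [(1 - P) V = (1 - E) x]. *)
Lemma poisson_equation x :
  let V := invmx (1%:M - P + E) *m (1%:M - E) *m x in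
  V + E *m x = x + P *m V.
Proof.
move=> V; have VE : (1%:M - P + E) *m V = (1%:M - E) *m x.
  by rewrite /V !mulmxA mulmxV ?fundamental_unit // mul1mx.
have EV : E *m V = 0.
  have : E *m ((1%:M - P + E) *m V) = E *m V.
    by rewrite mulmxA mulmxDr mulmxBr mulmx1 cesaro_mulr subrr add0r cesaro_idem.
  by rewrite VE mulmxA mulmxBr mulmx1 cesaro_idem subrr mul0mx.
move: VE; rewrite mulmxDl EV addr0 !mulmxBl !mul1mx => /eqP.
by rewrite subr_eq => /eqP {1}->; rewrite addrAC subrK.
Qed.

(** * Reachability and recurrence *)

Definition reach s t : Prop := exists k, 0 < (P ^+ k) s t.

Definition essential s : Prop := forall t, reach s t -> reach t s.

Lemma reach_refl s : reach s s.
Proof. by exists 0%N; rewrite expr0 mxE eqxx ltr01. Qed.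

Lemma reach_trans s t i : reach s t -> reach t i -> reach s i.
Proof.
move=> [k st] [l ti]; exists (k + l)%N; rewrite exprD -mulmxE mxE.
apply: (sumr_gt0_term _ _ t) => [j|]; last exact: mulr_gt0.
by rewrite mulr_ge0 // stochastic_ge0 //; exact: stochasticX.
Qed.

Lemma reach1 s t : 0 < P s t -> reach s t.
Proof. by exists 1%N. Qed.

Lemma essential_reach s t : essential s -> reach s t -> essential t.
Proof.
move=> es st i ti; apply: (reach_trans _ s) => //.
by apply: es; exact: reach_trans st ti.
Qed.

Lemma cesaro_reach s t : 0 < E s t -> reach s t.
Proof.
move=> Est; apply: contrapT => nst.
suff E0 : E s t = 0 by rewrite E0 ltxx in Est.
have Pk0 k : (P ^+ k) s t = 0.
  apply/eqP; rewrite eq_le stochastic_ge0 ?andbT; last exact: stochasticX.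
  by rewrite leNgt; apply/negP => Pk; apply: nst; exists k.
rewrite -(cvg_lim _ (cesaro_entry s t)) //.
under eq_fun => H do rewrite big1 // mulr0.
by rewrite lim_cst.
Qed.

(** A stationary row [w] cannot charge a state [t] that leads to a state [u]
    from which [t] is out of reach: mass would flow into the closed set of
    states reachable from [u] and never come back. *)
Lemma cesaro_essential s t : 0 < E s t -> essential t.
Proof.
move=> Est u [k tu]; apply: contrapT => nut.
set U := [set v | `[< reach u v >]]%SET.
have PU v : v \in U -> \sum_(j in U) (P ^+ k) v j = 1.
  rewrite inE => /asboolP uv.
  rewrite -[RHS](stochastic_sum1 _ v (stochasticX P k Ps)) [RHS](bigID (mem U)) /=.
  rewrite [X in _ = _ + X]big1 ?addr0 // => j; rewrite inE => /asboolP nuj.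
  apply/eqP; rewrite eq_le [X in _ && X]stochastic_ge0 ?andbT; last exact: stochasticX.
  rewrite leNgt; apply/negP => vj; apply: nuj; apply: reach_trans uv _.
  by exists k.
have mass : \sum_(j in U) E s j = \sum_i E s i * \sum_(j in U) (P ^+ k) i j.
  under [RHS]eq_bigr => i _ do rewrite mulr_sumr.
  rewrite exchange_big /=; apply: eq_bigr => j _.
  by rewrite -{1}(cesaro_mullX k) mxE.
have /negP[] : ~~ (0 < \sum_(i | i \notin U) E s i * \sum_(j in U) (P ^+ k) i j).
  move: mass; rewrite [RHS](bigID (mem U)) /= -leNgt.
  under [X in _ = X + _]eq_bigr => i iU do rewrite PU // mulr1.
  set leak := \sum_(_ | _ \notin U) _; set kept := \sum_(_ | _) _ => massE.
  by have -> : leak = 0 by lra.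
have tU : t \notin U by rewrite inE; apply/asboolP.
rewrite (bigD1 t) //= ltr_wpDr //.
  apply: sumr_ge0 => i _; rewrite mulr_ge0 ?cesaro_ge0 //.
  by apply: sumr_ge0 => j _; exact: stochastic_ge0 (stochasticX P k Ps).
rewrite mulr_gt0 // (bigD1 u) /=; last by rewrite inE; apply/asboolP/reach_refl.
rewrite ltr_wpDr // sumr_ge0 // => j _.
exact: stochastic_ge0 (stochasticX P k Ps).
Qed.

(** Row [s] of [E] charges some state [t]; [s] reaches [t], so [t] reaches [s],
    and stationarity carries the mass at [t] back to [s]. *)
Lemma essential_cesaro s : essential s -> 0 < E s s.
Proof.
move=> es; have [t Est] : exists t, 0 < E s t.
  apply: contrapT => /forallNP E0; have := stochastic_sum1 E s cesaro_stochastic.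
  rewrite big1 => [/eqP|t _]; first by rewrite eq_sym oner_eq0.
  by apply/eqP; rewrite eq_le cesaro_ge0 andbT leNgt; apply/negP/E0.
have [k ts] := es t (cesaro_reach _ _ Est).
rewrite -(cesaro_mullX k) mxE; apply: (sumr_gt0_term _ _ t) => [j|].
  by rewrite mulr_ge0 ?cesaro_ge0 // stochastic_ge0 //; exact: stochasticX.
exact: mulr_gt0.
Qed.

End CesaroLimit.

End Stochastic.

Section Recurrence.
Context {R : realType} {n : nat}.
Implicit Types (P : 'M[R]_n) (u : 'rV[R]_n) (x : 'cV[R]_n) (s t i j : 'I_n).

Lemma cvg_mulmx_col (A : 'M[R]_n) (X : nat -> 'cV[R]_n) x i :
  (forall j, X N j 0 @[N --> \oo] --> x j 0) ->
  (A *m X N) i 0 @[N --> \oo] --> (A *m x) i 0.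
Proof.
move=> Xx; rewrite mxE; under eq_cvg do rewrite mxE.
apply: (@cvg_big R^o _ +%R 0) => [|j _]; first exact: add_continuous.
by apply: cvgMr; exact: Xx.
Qed.

Section Survival.
Variables (P : 'M[R]_n) (s : 'I_n).
Hypothesis Ps : stochastic P.

(** [survival N i] is the probability that the chain started at [i] avoids
    [s] at the times [1, ..., N]. *)
Definition survival (N : nat) : 'cV[R]_n := taboo P s ^+ N *m const_mx 1.

Lemma taboo_ge0 i j : 0 <= taboo P s i j.
Proof. by rewrite mxE; case: ifP => // _; exact: stochastic_ge0. Qed.

Lemma taboo_mulE x : taboo P s *m x = P *m x - x s 0 *: col s P.
Proof.
apply/matrixP => i j; rewrite ord1 !mxE (bigD1 s) //= [in RHS](bigD1 s) //=.
rewrite !mxE eqxx mul0r add0r [x s 0 * _]mulrC addrAC subrr add0r.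
by apply: eq_bigr => k /negPf ks; rewrite !mxE ks.
Qed.

Lemma survivalS N : survival N.+1 = taboo P s *m survival N.
Proof. by rewrite /survival exprS -mulmxE mulmxA. Qed.

Lemma survival_ge0 N i : 0 <= survival N i 0.
Proof.
elim: N i => [|N IHN] i; first by rewrite /survival expr0 mul1mx mxE.
rewrite survivalS mxE; apply: sumr_ge0 => j _.
by rewrite mulr_ge0 ?taboo_ge0.
Qed.

Lemma survival_drop N i :
  survival N i 0 - survival N.+1 i 0 = (taboo P s ^+ N *m P) i s.
Proof.
rewrite /survival exprSr -mulmxE -mulmxA taboo_mulE (stochastic_mul1 P) // mulmxBr.
rewrite [const_mx 1 s 0]mxE scale1r colE mulmxA -colE.
by move: (taboo P s ^+ N *m _) => a; rewrite !mxE opprB addrC subrK.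
Qed.

(** The chain first returns at one of the times [1, ..., N] or survives up to
    time [N]; the drop of the survival at each step is the return there. *)
Lemma first_return_sum N : series (first_return P s) N = 1 - survival N s 0.
Proof.
rewrite /series /=; elim: N => [|N IHN].
  by rewrite big_geq // /survival expr0 mul1mx mxE subrr.
by rewrite big_nat_recr //= IHN /first_return -survival_drop; ring.
Qed.

(** The probability of never visiting [s] at a positive time. *)
Definition escape : 'cV[R]_n := \col_i limn (fun N => survival N i 0).

Lemma survival_cvg i : survival N i 0 @[N --> \oo] --> escape i 0.
Proof.
rewrite mxE; apply: nonincreasing_is_cvgn.
  apply/nonincreasing_seqP => N; rewrite -subr_ge0 survival_drop.
  apply: mulmx_ge0 => [a b|a b]; last exact: stochastic_ge0.
  elim: N a b => [|N IHN] a b; first by rewrite expr0 mxE ler0n.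
  by rewrite exprS -mulmxE; apply: mulmx_ge0 => // ? ?; exact: taboo_ge0.
by exists 0 => _ [N _ <-]; exact: survival_ge0.
Qed.

Lemma escape_ge0 i : 0 <= escape i 0.
Proof.
apply: (cvgr_to_ge (survival_cvg i)); apply: nearW => N.
exact: survival_ge0.
Qed.

Lemma recurrent_escape : recurrent_state P s <-> escape s 0 = 0.
Proof.
have cvg1 : series (first_return P s) @ \oo --> 1 - escape s 0.
  under eq_cvg do rewrite first_return_sum.
  by apply: cvgB; [exact: cvg_cst|exact: survival_cvg].
rewrite /recurrent_state; split=> [c|e0]; last by rewrite e0 subr0 in cvg1.
have h : 1 = 1 - escape s 0 by apply: cvg_unique c cvg1; exact: Rhausdorff.
by rewrite -[RHS](subrr 1) {2}h opprB addrC subrK.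
Qed.

Lemma mul_escape : P *m escape = escape + escape s 0 *: col s P.
Proof.
apply/eqP; rewrite -subr_eq -taboo_mulE; apply/eqP/matrixP => i j.
rewrite ord1; have := cvg_mulmx_col (taboo P s) survival escape i survival_cvg.
under eq_cvg do rewrite -survivalS.
rewrite (cvg_shiftS (fun N => survival N i 0)) => c.
by apply: cvg_unique c (survival_cvg i) => //; exact: Rhausdorff.
Qed.

Lemma survival_unreach N i : ~ reach P i s -> survival N i 0 = 1.
Proof.
elim: N i => [|N IHN] i nis; first by rewrite /survival expr0 mul1mx mxE.
rewrite survivalS taboo_mulE -[RHS](stochastic_sum1 P i Ps).
have Pis : P i s = 0.
  apply/eqP; rewrite eq_le stochastic_ge0 // andbT leNgt; apply/negP => Pis.
  by apply: nis; exact: reach1.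
rewrite !mxE Pis mulr0 subr0; apply: eq_bigr => j _.
have [->|Pij] := eqVneq (P i j) 0; first by rewrite mul0r.
rewrite IHN ?mulr1 // => js; apply: nis; apply: (reach_trans P Ps i j) => //.
by apply: reach1; rewrite lt0r Pij stochastic_ge0.
Qed.

(** If [s] is recurrent, the escape probability is harmonic and vanishes at
    [s], hence at every state that [s] reaches; but it is [1] at a state from
    which [s] is out of reach.  Conversely the Cesaro limit [E], being
    stationary, kills the defect [escape s *: col s P] of [mul_escape], and its
    entry at [s, s] is positive when [s] is essential. *)
Lemma recurrent_essential : recurrent_state P s <-> essential P s.
Proof.
rewrite recurrent_escape; split=> [e0 u [k su]|es].
  apply: contrapT => nus.
  have e1 : escape u 0 = 1.
    have c1 : survival N u 0 @[N --> \oo] --> (1 : R).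
      by under eq_cvg do rewrite survival_unreach //; exact: cvg_cst.
    by apply: cvg_unique (survival_cvg u) c1; exact: Rhausdorff.
  have := mulmx_iter_fix P escape k.
  rewrite mul_escape e0 scale0r addr0 => /(_ erefl)/matrixP/(_ s 0)/eqP.
  rewrite e0 mxE gt_eqF //.
  apply: (sumr_gt0_term _ _ u) => [j|]; last by rewrite e1 mulr1.
  by rewrite mulr_ge0 ?escape_ge0 // stochastic_ge0 //; exact: stochasticX.
have : cesaro_limit P *m (P *m escape) = cesaro_limit P *m escape.
  by rewrite mulmxA cesaro_mulr.
rewrite mul_escape mulmxDr => /eqP.
rewrite -subr_eq0 addrAC subrr add0r => /eqP/matrixP/(_ s 0).
rewrite -scalemxAr colE mulmxA cesaro_mulr // -colE.
move: (escape s 0) (cesaro_limit P) (essential_cesaro P Ps s es) => e E Ess.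
by rewrite !mxE => /eqP; rewrite mulf_eq0 => /orP[/eqP//|]; rewrite gt_eqF.
Qed.

End Survival.

(** [E] annihilates the conditional variance [P (f^2) - f^2] of a harmonic [f],
    so that variance vanishes at [s] when [E s s] is positive. *)
Lemma harmonic_const P (f : 'cV[R]_n) s j : stochastic P -> P *m f = f ->
  essential P s -> 0 < P s j -> f j 0 = f s 0.
Proof.
move=> Ps Pf es Psj; set E := cesaro_limit P.
pose f2 : 'cV[R]_n := \col_i (f i 0) ^+ 2.
have varE i : (P *m f2 - f2) i 0 = \sum_l P i l * (f l 0 - f i 0) ^+ 2.
  transitivity (\sum_l P i l * f l 0 ^+ 2 - 2 * f i 0 * (P *m f) i 0
                + (\sum_l P i l) * f i 0 ^+ 2).
    rewrite stochastic_sum1 // Pf !mxE.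
    under eq_bigr => l _ do rewrite mxE.
    by ring.
  rewrite mxE mulr_sumr mulr_suml -sumrB -big_split /=.
  by apply: eq_bigr => l _; ring.
have Evar : E *m (P *m f2 - f2) = 0.
  by rewrite mulmxBr mulmxA cesaro_mulr // subrr.
have var0 : (P *m f2 - f2) s 0 = 0.
  apply/eqP; rewrite eq_le [in X in _ && X]varE [X in _ && X]sumr_ge0 ?andbT; last first.
    by move=> l _; rewrite mulr_ge0 ?sqr_ge0 // stochastic_ge0.
  rewrite leNgt; apply/negP => vs.
  have /matrixP/(_ s 0)/eqP := Evar; rewrite [X in _ == X]mxE mxE gt_eqF //.
  apply: (sumr_gt0_term _ _ s) => [i|]; last first.
    by rewrite mulr_gt0 // essential_cesaro.
  rewrite mulr_ge0 ?cesaro_ge0 // varE sumr_ge0 // => l _.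
  by rewrite mulr_ge0 ?sqr_ge0 // stochastic_ge0.
have := var0; rewrite varE => /eqP.
rewrite psumr_eq0 => [|l _]; last by rewrite mulr_ge0 ?sqr_ge0 // stochastic_ge0.
move=> /allP/(_ j (mem_index_enum _)) /=.
by rewrite mulf_eq0 gt_eqF //= sqrf_eq0 subr_eq0 => /eqP.
Qed.

Lemma powS_gt0 P k s t : stochastic P -> 0 < (P ^+ k.+1) s t ->
  exists j, 0 < P s j /\ 0 < (P ^+ k) j t.
Proof.
rewrite exprS -mulmxE mxE => Ps st; apply: contrapT => /forallNP nj.
move: st; rewrite big1 ?ltxx // => j _.
apply/eqP; rewrite mulf_eq0; apply/orP.
have := nj j; rewrite not_andP => -[]/negP; rewrite -leNgt => h.
  by left; rewrite eq_le h stochastic_ge0.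
by right; rewrite eq_le h stochastic_ge0 //; exact: stochasticX.
Qed.

Lemma harmonic_const_reach P (f : 'cV[R]_n) s t : stochastic P -> P *m f = f ->
  essential P s -> reach P s t -> f t 0 = f s 0.
Proof.
move=> Ps Pf es [k]; elim: k s es => [|k IHk] s es.
  by rewrite expr0 mxE; case: eqP => [->//|_]; rewrite ltxx.
move=> /(powS_gt0 _ _ _ _ Ps)[j [sj jt]].
rewrite (IHk j) //; last exact: essential_reach (reach1 _ _ _ sj).
exact: harmonic_const sj.
Qed.

Lemma stochastic_avg_const P (f : 'cV[R]_n) s : stochastic P ->
  (forall j, 0 < P s j -> f j 0 = f s 0) -> (P *m f) s 0 = f s 0.
Proof.
move=> Ps fc; rewrite -[RHS]mul1r -(stochastic_sum1 P s Ps) mulr_suml mxE.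
apply: eq_bigr => j _; have [->|Psj] := eqVneq (P s j) 0; first by rewrite !mul0r.
by rewrite fc // lt0r Psj stochastic_ge0.
Qed.

Lemma reach_support P P' s t : stochastic P -> stochastic P' ->
  (forall i j, 0 < P i j -> 0 < P' i j) -> reach P s t -> reach P' s t.
Proof.
move=> Ps Ps' PP' [k]; elim: k s => [|k IHk] s; first by exists 0%N.
move=> /(powS_gt0 _ _ _ _ Ps)[j [sj jt]].
by apply: reach_trans (IHk _ jt) => //; exact/reach1/PP'.
Qed.

Lemma essential_support P P' s : stochastic P -> stochastic P' ->
  (forall i j, (0 < P i j) = (0 < P' i j)) -> essential P s -> essential P' s.
Proof.
move=> Ps Ps' PP' es t st; apply: (reach_support P) => // [i j|].
  by rewrite PP'.
by apply: es; apply: (reach_support P') => // i j; rewrite PP'.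
Qed.

(** * The chain killed outside a set of inessential states *)

Section Killed.
Variables (P : 'M[R]_n) (D : {set 'I_n}).
Hypothesis Ps : stochastic P.
Hypothesis D_inessential : forall s, s \in D -> ~ essential P s.

(** [Tbar] is the instance where [D] is the set of transient states. *)
Definition killed : 'M[R]_n :=
  \matrix_(i, j) if (i \in D) && (j \in D) then P i j else 0.

Lemma killed_ge0 i j : 0 <= killed i j.
Proof. by rewrite mxE; case: ifP => // _; exact: stochastic_ge0. Qed.

Lemma killed_le i j : killed i j <= P i j.
Proof. by rewrite mxE; case: ifP => // _; exact: stochastic_ge0. Qed.

(** Since [u] and [u P] have the same total mass, [u <= u P] forces
    [u = u P], so [u] charges essential states only, where [u <= u killed]
    makes it vanish. *)
Lemma killed_subinvariant u : (forall j, 0 <= u 0 j) ->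
  (forall j, u 0 j <= (u *m killed) 0 j) -> u = 0.
Proof.
move=> u0 uK; have uP j : u 0 j <= (u *m P) 0 j.
  apply: le_trans (uK j) _; rewrite !mxE; apply: ler_sum => i _.
  by rewrite ler_wpM2l ?killed_le.
have mass : \sum_j ((u *m P) 0 j - u 0 j) = 0.
  rewrite sumrB; apply/eqP; rewrite subr_eq0; apply/eqP.
  have /matrixP/(_ 0 0) : u *m P *m const_mx 1 = u *m const_mx 1 :> 'cV[R]_1.
    by rewrite -mulmxA stochastic_mul1.
  have massE (w : 'rV[R]_n) : (w *m (const_mx 1 : 'cV[R]_n)) 0 0 = \sum_j w 0 j.
    by rewrite mxE; apply: eq_bigr => j _; rewrite mxE mulr1.
  by rewrite !massE.
have uPE : u *m P = u.
  apply/matrixP => i j; rewrite ord1; apply/eqP; rewrite -subr_eq0.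
  move/eqP: mass; rewrite psumr_eq0 => [/allP/(_ j (mem_index_enum _))//|l _].
  by rewrite subr_ge0.
have uD j : j \in D -> u 0 j = 0.
  move=> jD; rewrite -(cesaro_fixl P Ps u uPE) mxE big1 // => i _.
  have [->|Eij] := eqVneq (cesaro_limit P i j) 0; first by rewrite mulr0.
  case: (D_inessential j jD); apply: (cesaro_essential P Ps i).
  by rewrite lt0r Eij cesaro_ge0.
apply/matrixP => i j; rewrite ord1 [RHS]mxE; have [/uD//|jD] := boolP (j \in D).
apply/eqP; rewrite eq_le u0 andbT (le_trans (uK j)) // mxE big1 // => l _.
by rewrite mxE (negPf jD) andbF mulr0.
Qed.

Lemma killed_unit : 1%:M - killed \in unitmx.
Proof.
rewrite -row_free_unit; apply: inj_row_free => u.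
rewrite mulmxBr mulmx1 => /eqP; rewrite subr_eq0 => /eqP uK.
have u0 : \row_j `|u 0 j| = 0.
  apply: killed_subinvariant => j; first by rewrite mxE.
  rewrite [leLHS]mxE [leRHS]mxE {1}uK [X in `|X|]mxE.
  rewrite (le_trans (ler_norm_sum _ _ _)) // ler_sum // => i _.
  by rewrite normrM (ger0_norm (killed_ge0 i j)) [in leRHS]mxE.
apply/matrixP => i j; rewrite ord1 [RHS]mxE; apply/normr0_eq0.
by have /matrixP/(_ 0 j) := u0; rewrite !mxE.
Qed.

(** The row [y = u (1 - killed)^-1] satisfies [y = u + y killed]; its negative
    part is subinvariant, hence zero. *)
Lemma killed_visits_ge u j : (forall i, 0 <= u 0 i) ->
  u 0 j <= (u *m invmx (1%:M - killed)) 0 j.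
Proof.
move=> u0; set y := u *m _.
have yE i : y 0 i = u 0 i + (y *m killed) 0 i.
  have : y *m (1%:M - killed) = u by rewrite mulmxKV // killed_unit.
  by rewrite mulmxBr mulmx1 => <-; rewrite !mxE subrK.
have neg0 : \row_i Num.max (- y 0 i) 0 = 0.
  apply: killed_subinvariant => i; rewrite mxE ?le_max ?lexx ?orbT //.
  have K0 : 0 <= ((\row_l Num.max (- y 0 l) 0) *m killed) 0 i.
    rewrite mxE sumr_ge0 // => l _; rewrite mxE mulr_ge0 ?killed_ge0 //.
    by rewrite le_max lexx orbT.
  rewrite ge_max K0 andbT yE opprD (@le_trans _ _ (- (y *m killed) 0 i)) //.
    by rewrite gerDr oppr_le0.
  rewrite [X in - X]mxE [leRHS]mxE -sumrN ler_sum // => l _.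
  by rewrite -mulNr ler_wpM2r ?killed_ge0 // [leRHS]mxE le_max lexx.
have y0 i : 0 <= y 0 i.
  have /matrixP/(_ 0 i) := neg0; rewrite !mxE => h.
  by rewrite -oppr_le0 -[leRHS]h le_max lexx.
rewrite [leRHS]yE lerDl mxE sumr_ge0 // => i _.
by rewrite mulr_ge0 ?killed_ge0.
Qed.

End Killed.

End Recurrence.

(** * Average reward of a policy *)

Section AverageReward.
Context {R : realType} {n m : nat}.
Variable M : mdp R n m.
Implicit Types (pi : 'M[R]_(n, m)) (mu nu : 'rV[R]_n) (s t : 'I_n) (a : 'I_m).

Lemma policy_pos_policy pi : policy_pos pi -> policy pi.
Proof. by case. Qed.

Lemma policy_ge_pos alpha pi : 0 < alpha -> policy_ge alpha pi -> policy_pos pi.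
Proof. by move=> a0 [pip pia]; split=> // s a; exact: lt_le_trans (pia s a). Qed.

Lemma policy_ge0 pi s a : policy pi -> 0 <= pi s a.
Proof. by move=> /(_ s)[+ _] => /(_ a); rewrite mxE. Qed.

Lemma policy_sum1 pi s : policy pi -> \sum_a pi s a = 1.
Proof. by move=> /(_ s)[_ <-]; apply: eq_bigr => a _; rewrite mxE. Qed.

Lemma trans_ge0 s a t : 0 <= trans M s a 0 t.
Proof. by have [+ _] := trans_distr M s a; exact. Qed.

Lemma Ppol_mulE pi (f : 'cV[R]_n) s :
  (Ppol M pi *m f) s 0 = \sum_a pi s a * Pf M f s a.
Proof.
rewrite mxE; under eq_bigr => t _ do rewrite mxE mulr_suml.
rewrite exchange_big /=; apply: eq_bigr => a _; rewrite mxE mulr_sumr.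
by apply: eq_bigr => t _; rewrite mulrA.
Qed.

Lemma Ppol_stochastic pi : policy pi -> stochastic (Ppol M pi).
Proof.
move=> pip; apply: stochasticP => [s t|].
  by rewrite mxE; apply: sumr_ge0 => a _; rewrite mulr_ge0 ?policy_ge0 ?trans_ge0.
apply/matrixP => s j; rewrite ord1 Ppol_mulE [RHS]mxE -[RHS](policy_sum1 pi s pip).
apply: eq_bigr => a _; rewrite mxE; under eq_bigr => t _ do rewrite mxE mulr1.
by have [_ ->] := trans_distr M s a; rewrite mulr1.
Qed.

Lemma big_tupleS (S A : finType) (H : nat) (F : seq (S * A) -> R) :
  \sum_(tau : H.+1.-tuple (S * A)) F tau =
  \sum_x \sum_y \sum_(tau : H.-tuple (S * A)) F ((x, y) :: tau).
Proof.
rewrite (pair_bigA _ (fun x y => \sum_(tau : H.-tuple _) F ((x, y) :: tau))) /=.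
rewrite pair_big /=.
rewrite (reindex (fun p : (S * A) * H.-tuple (S * A) => [tuple of p.1 :: p.2])) /=.
  by apply: eq_bigr => -[[x y] tau] _.
exists (fun tau : H.+1.-tuple (S * A) => (thead tau, [tuple of behead tau])).
  by move=> [x t] _; rewrite theadE; congr (_, _); exact: val_inj.
by move=> t _; rewrite [RHS]tuple_eta; exact: val_inj.
Qed.

Lemma traj_prob_sum1 pi nu H : policy pi -> distr nu ->
  \sum_(tau : H.-tuple ('I_n * 'I_m)) traj_prob M pi nu tau = 1.
Proof.
move=> pip; elim: H nu => [|H IHH] nu [nu0 nu1].
  rewrite (bigD1 [tuple]) //= big1 ?addr0 // => tau /eqP[].
  exact: tuple0.
rewrite big_tupleS -[RHS]nu1 /=.
apply: eq_bigr => s _; under eq_bigr => a _.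
  rewrite -mulr_sumr IHH; last exact: trans_distr.
  rewrite mulr1; over.
by rewrite -mulr_sumr policy_sum1 ?mulr1.
Qed.

(** Conditioning on the first step, with a general initial law [nu] because the
    state after that step has law [trans M s a]. *)
Lemma traj_return pi nu H : policy pi -> distr nu ->
  \sum_(tau : H.-tuple ('I_n * 'I_m))
    traj_prob M pi nu tau * \sum_(x <- tau) reward M x.1 x.2 =
  (nu *m (\sum_(k < H) Ppol M pi ^+ k *m rpol M pi)) 0 0.
Proof.
move=> pip; elim: H nu => [|H IHH] nu nup.
  rewrite big_ord0 mulmx0 mxE big1 // => t _.
  by rewrite tuple0 big_nil mulr0.
set W := \sum_(k < H) Ppol M pi ^+ k *m rpol M pi.
rewrite (big_tupleS _ _ _ (fun tau => traj_prob M pi nu tau *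
  \sum_(x <- tau) reward M x.1 x.2)) /=.
have -> : \sum_(k < H.+1) Ppol M pi ^+ k *m rpol M pi =
    rpol M pi + Ppol M pi *m W.
  rewrite big_ord_recl expr0 mul1mx mulmx_sumr; congr (_ + _).
  by apply: eq_bigr => k _; rewrite exprS -mulmxE mulmxA.
rewrite mxE; apply: eq_bigr => s _; rewrite [in RHS]mxE Ppol_mulE mxE.
rewrite -big_split mulr_sumr; apply: eq_bigr => a _ /=.
under eq_bigr => tau _ do
  rewrite big_cons /= mulrDr -!(mulrA (nu 0 s * pi s a)) [_ * reward _ _ _]mulrC.
rewrite big_split /= -!mulr_sumr traj_prob_sum1 ?IHH //; try exact: trans_distr.
rewrite -/W [Pf _ _ _ _]mxE [(_ *m W) 0 0]mxE; ring.
Qed.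

Lemma expected_returnE pi s H : policy pi ->
  expected_return M pi s H = \sum_(k < H) (Ppol M pi ^+ k *m rpol M pi) s 0.
Proof.
move=> pip; rewrite /expected_return traj_return //.
  by rewrite -rowE mxE summxE.
split=> [j|]; first by rewrite mxE ler0n.
rewrite (bigD1 s) //= mxE !eqxx big1 ?addr0 // => j /negPf js.
by rewrite mxE js andbF.
Qed.

Lemma JE pi : policy pi -> J M pi = Pstar M pi *m rpol M pi.
Proof.
move=> pip; apply/matrixP => s j; rewrite ord1 mxE.
have c := cvg_cesaro _ (Ppol_stochastic pi pip) (rpol M pi) s.
rewrite -(cvg_limn_inf_sup c).1; congr limn_inf; apply/funext => H.
by rewrite expected_returnE.
Qed.

Lemma J_harmonic pi : policy pi -> Ppol M pi *m J M pi = J M pi.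
Proof.
by move=> pip; rewrite JE // mulmxA cesaro_mull //; exact: Ppol_stochastic.
Qed.

Lemma V_poisson pi : policy pi ->
  V M pi + J M pi = rpol M pi + Ppol M pi *m V M pi.
Proof. by move=> pip; rewrite JE //; exact/poisson_equation/Ppol_stochastic. Qed.

Lemma Ppol_gt0 pi s t : policy_pos pi ->
  (0 < Ppol M pi s t) = [exists a, 0 < trans M s a 0 t].
Proof.
move=> [pip pi0]; rewrite mxE; apply/idP/existsP => [|[a ta]]; last first.
  apply: (sumr_gt0_term _ _ a) => [b|]; last exact: mulr_gt0.
  by rewrite mulr_ge0 ?policy_ge0 ?trans_ge0.
apply: contraPP => /forallNP nt; rewrite big1 ?ltxx // => a _.
have := nt a; move/negP; rewrite -leNgt => ta.
by apply/eqP; rewrite mulf_eq0 [X in _ || X]eq_le ta trans_ge0 orbT.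
Qed.

Lemma rec_statesP pi s : policy_pos pi ->
  s \in rec_states M <-> essential (Ppol M pi) s.
Proof.
move=> pip; rewrite inE; split=> [/asboolP/(_ pi pip)|es].
  by move/recurrent_essential; apply; exact/Ppol_stochastic/policy_pos_policy.
apply/asboolP => pi' pip'; apply/recurrent_essential.
  exact/Ppol_stochastic/policy_pos_policy.
apply: essential_support es => [||i j]; last by rewrite !Ppol_gt0.
  exact/Ppol_stochastic/policy_pos_policy.
exact/Ppol_stochastic/policy_pos_policy.
Qed.

Lemma in_trans_states s : (s \in trans_states M) = (s \notin rec_states M).
Proof. exact: finset.in_setC. Qed.

Lemma trans_states_inessential pi s : policy_pos pi ->
  s \in trans_states M -> ~ essential (Ppol M pi) s.
Proof. by move=> pip; rewrite in_trans_states => /negP ns /(rec_statesP pi s pip). Qed.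

Lemma J_const_reach pi pi' s t : policy_pos pi -> policy_pos pi' ->
  s \in rec_states M -> reach (Ppol M pi') s t -> J M pi t 0 = J M pi s 0.
Proof.
move=> pip pip' /(rec_statesP pi s pip) es st.
have Ps := Ppol_stochastic _ (policy_pos_policy _ pip).
apply: harmonic_const_reach es _ => //.
  exact/J_harmonic/policy_pos_policy.
apply: reach_support st => // [|i j].
  exact/Ppol_stochastic/policy_pos_policy.
by rewrite !Ppol_gt0.
Qed.

Lemma Pstar_trans pi s t : policy_pos pi -> t \in trans_states M ->
  Pstar M pi s t = 0.
Proof.
move=> pip tT; have Ps := Ppol_stochastic _ (policy_pos_policy _ pip).
apply/eqP/contraT => st; case: (trans_states_inessential _ _ pip tT).
by apply: (cesaro_essential _ Ps s); rewrite lt0r st cesaro_ge0.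
Qed.

(** * Performance difference *)

Section PerformanceDifference.
Variables pi pi' : 'M[R]_(n, m).
Hypotheses (pip : policy_pos pi) (pip' : policy_pos pi').
Let Ps := Ppol_stochastic _ (policy_pos_policy _ pip).
Let Ps' := Ppol_stochastic _ (policy_pos_policy _ pip').

(** By [V_poisson], averaging [Q] against [pi] gives [V]; averaging it against
    [pi'] gives [rpol pi' + P' V - P' J], and [Pstar pi'] absorbs [P']. *)
Lemma Q_advantage :
  Pstar M pi' *m (\col_s \sum_a Q M pi s a * (pi' s a - pi s a)) =
  J M pi' - Pstar M pi' *m J M pi.
Proof.
have avgQ p s : policy p -> \sum_a p s a * Q M pi s a =
    (rpol M p + Ppol M p *m V M pi - Ppol M p *m J M pi) s 0.
  move=> pp; rewrite [RHS]mxE [X in X + _]mxE [X in _ + X]mxE !Ppol_mulE.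
  rewrite [rpol M p s 0]mxE -big_split /= -sumrB; apply: eq_bigr => a _.
  by rewrite !mxE /K; ring.
have -> : \col_s \sum_a Q M pi s a * (pi' s a - pi s a) =
    rpol M pi' + Ppol M pi' *m V M pi - Ppol M pi' *m J M pi - V M pi.
  apply/matrixP => s j; rewrite ord1 [RHS]mxE -avgQ; last exact: policy_pos_policy.
  have -> : (- V M pi) s 0 = - \sum_a pi s a * Q M pi s a.
    rewrite avgQ; last exact: policy_pos_policy.
    rewrite -V_poisson ?J_harmonic; try exact: policy_pos_policy.
    by rewrite addrK [LHS]mxE.
  rewrite mxE -sumrB; apply: eq_bigr => a _; ring.
have EP := cesaro_mulr _ Ps' : Pstar M pi' *m Ppol M pi' = Pstar M pi'.
rewrite (JE pi'); last exact: policy_pos_policy.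
rewrite 2!mulmxBr mulmxDr 2!(mulmxA (Pstar M pi')) EP.
by rewrite addrAC addrK.
Qed.

Lemma J_drift s : \sum_a K M pi s a * (pi' s a - pi s a) =
  (Ppol M pi' *m J M pi - J M pi) s 0.
Proof.
rewrite -{2}(J_harmonic pi); last exact: policy_pos_policy.
rewrite [RHS]mxE [X in _ + X]mxE !Ppol_mulE -sumrB.
by apply: eq_bigr => a _; rewrite /K; ring.
Qed.

(** [J pi] is constant on what a recurrent state reaches, and the rows of [P']
    and [Pstar'] at that state are averages over such states. *)
Lemma J_rec s : s \in rec_states M ->
  (Ppol M pi' *m J M pi) s 0 = J M pi s 0 /\
  (Pstar M pi' *m J M pi) s 0 = J M pi s 0.
Proof.
move=> sR; split; apply: stochastic_avg_const => //.
- by move=> t st; apply: J_const_reach pip pip' sR _; exact: reach1.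
- exact: cesaro_stochastic.
- by move=> t st; apply: J_const_reach pip pip' sR _; exact: cesaro_reach.
Qed.

(** Write [P'], [Pstar'] for the matrices of [pi'] and [x] for [Pstar' J - J].
    By [P' Pstar' = Pstar'], [x - P' x = P' J - J]; as [x] vanishes on the
    recurrent states, [P'] may be replaced by its transient block. *)
Lemma killed_drift : (1%:M - Tbar M pi') *m (Pstar M pi' *m J M pi - J M pi) =
  Ppol M pi' *m J M pi - J M pi.
Proof.
set x := Pstar M pi' *m J M pi - J M pi.
have xR s : s \in rec_states M -> x s 0 = 0.
  by move=> sR; rewrite /x [LHS]mxE (J_rec s sR).2 [X in _ + X]mxE subrr.
apply/matrixP => s j; rewrite ord1 mulmxBl mul1mx.
have [sR|sT] := boolP (s \in rec_states M).
  rewrite [LHS]mxE [RHS]mxE xR // (J_rec s sR).1 [X in _ = _ + X]mxE subrr add0r.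
  rewrite mxE mxE big1 ?oppr0 // => t _.
  by rewrite mxE in_trans_states sR mul0r.
have -> : (x - Tbar M pi' *m x) s 0 = (x - Ppol M pi' *m x) s 0.
  rewrite [LHS]mxE [RHS]mxE; congr (_ + _).
  rewrite [LHS]mxE [RHS]mxE; congr (- _).
  rewrite [LHS]mxE [RHS]mxE; apply: eq_bigr => t _.
  rewrite [Tbar _ _ _ _]mxE !in_trans_states sT /=.
  by have [tR|] := boolP (t \in rec_states M); rewrite //= xR // !mulr0.
congr (_ s 0); rewrite /x mulmxBr mulmxA cesaro_mull //.
by rewrite opprB addrC addrA subrK.
Qed.

(** The first-order expansion of the average reward is exact.  Only recurrent
    states are charged by [d_visit], where [Q_advantage] applies; on transient
    states the drift of [J pi] under [pi'] is summed by [killed_drift]. *)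
Lemma performance_difference mu :
  Jmu M mu pi' - Jmu M mu pi =
  \sum_s rho M mu pi' 0 s * \sum_a G M pi s a * (pi' s a - pi s a).
Proof.
set A := \col_s \sum_a Q M pi s a * (pi' s a - pi s a).
set D := Ppol M pi' *m J M pi - J M pi.
have GE s : \sum_a G M pi s a * (pi' s a - pi s a) =
    if s \in rec_states M then A s 0 else D s 0.
  rewrite /D -J_drift [A s 0]mxE; case: ifP => sR; apply: eq_bigr => a _;
  by rewrite [G _ _ _ _]mxE in_trans_states sR /= ?mulr0 ?mulr1 ?addr0 ?add0r.
have JmuE p : Jmu M mu p = (mu *m J M p) 0 0 by rewrite mxE.
have dA : \sum_s (d_visit M mu pi' 0 s * A s 0) =
    (mu *m (J M pi' - Pstar M pi' *m J M pi)) 0 0.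
  by rewrite -Q_advantage mulmxA mxE.
have dD : \sum_s (delta_visit M mu pi' 0 s * D s 0) =
    (mu *m (Pstar M pi' *m J M pi - J M pi)) 0 0.
  rewrite /D -killed_drift.
  transitivity ((delta_visit M mu pi' *m ((1%:M - Tbar M pi') *m
    (Pstar M pi' *m J M pi - J M pi))) 0 0); first by rewrite [RHS]mxE.
  rewrite /delta_visit mulmxA mulmxKV //; apply: killed_unit => // s.
  exact: trans_states_inessential.
transitivity (\sum_s (d_visit M mu pi' 0 s * A s 0) +
              \sum_s (delta_visit M mu pi' 0 s * D s 0)).
  rewrite dA dD !JmuE !mulmxBr.
  by rewrite ![in RHS]mxE ![in LHS]mxE; ring.
rewrite -big_split /=; apply: eq_bigr => s _; rewrite GE [rho _ _ _ _ _]mxE in_trans_states.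
case: ifP => sR /=; rewrite ?mulr0 ?mulr1 ?addr0 ?add0r.
  suff -> : D s 0 = 0 by rewrite mulr0 addr0.
  by rewrite /D [LHS]mxE (J_rec s sR).1 [X in _ + X]mxE subrr.
suff -> : d_visit M mu pi' 0 s = 0 by rewrite mul0r add0r.
rewrite mxE big1 // => t _; rewrite Pstar_trans ?mulr0 //.
by rewrite in_trans_states sR.
Qed.

End PerformanceDifference.

Lemma rho_gt0 mu pi s : distr_pos mu -> policy_pos pi -> 0 < rho M mu pi 0 s.
Proof.
move=> [[mu0 _] mup] pip; have Ps := Ppol_stochastic _ (policy_pos_policy _ pip).
rewrite mxE in_trans_states; have [sR|sT] := boolP (s \in rec_states M) => /=.
  rewrite mulr0 mulr1 addr0 mxE; apply: (sumr_gt0_term _ _ s) => [t|].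
    by rewrite mulr_ge0 ?cesaro_ge0.
  rewrite mulr_gt0 //; apply: essential_cesaro => //.
  exact/rec_statesP.
rewrite mulr0 mulr1 add0r; apply: lt_le_trans (mup s) _.
apply: killed_visits_ge => // t; exact: trans_states_inessential.
Qed.

(** A supremum in [R] is [0] unless the set is nonempty and bounded, so the
    positivity of [Calpha] makes it an upper bound. *)
Lemma rho_le_Calpha alpha mu pi pi' s : 0 < alpha -> distr_pos mu ->
  0 < Calpha M alpha mu -> policy_ge alpha pi -> policy_ge alpha pi' ->
  rho M mu pi 0 s <= Calpha M alpha mu * rho M mu pi' 0 s.
Proof.
move=> a0 mup C0 pia pia'.
rewrite -ler_pdivrMr; last by apply: rho_gt0 => //; exact: policy_ge_pos pia'.
rewrite /Calpha; apply: ub_le_sup; last by exists s, pi, pi'.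
have [[]//|/sup_out sup0] := pselect (has_sup [set x : R | exists s pi pi',
  [/\ policy_ge alpha pi, policy_ge alpha pi' &
      x = rho M mu pi 0 s / rho M mu pi' 0 s]]).
by move: C0; rewrite /Calpha sup0 ltxx.
Qed.

End AverageReward.

(** * The Bregman divergence *)

Section Bregman.
Context {R : realType} {m : nat}.
Implicit Types p q x y v : 'rV[R]_m.

Lemma distr_ge_relint alpha p : 0 < alpha ->
  distr_ge alpha p -> relint (distr (k := m)) p.
Proof.
move=> a0 [pd pa]; split=> //; apply: filterS (nbhsx_ballx p alpha a0) => y py.
move=> [k [c [z [zd c1 yE]]]]; split=> [i|].
  case: py => _ /(_ 0 i); rewrite /ball /= => /ltr_normlP[_ h].
  by have := pa i; lra.
rewrite yE; under eq_bigr => i _ do rewrite summxE.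
rewrite exchange_big /= -[RHS]c1; apply: eq_bigr => j _.
under eq_bigr => i _ do rewrite mxE.
by rewrite -mulr_sumr (zd j).2 mulr1.
Qed.

Lemma distr_ge_conv alpha p q (t : R) : 0 <= t <= 1 ->
  distr_ge alpha p -> distr_ge alpha q -> distr_ge alpha (p + t *: (q - p)).
Proof.
move=> t01 [[p0 p1] pa] [[q0 q1] qa].
have ge b i : b <= p 0 i -> b <= q 0 i -> b <= (p + t *: (q - p)) 0 i.
  by rewrite !mxE; nra.
split=> [|i]; last exact: ge.
split=> [i|]; first exact: ge.
transitivity (\sum_i p 0 i + t * (\sum_i q 0 i - \sum_i p 0 i)); last first.
  by rewrite p1 q1 subrr mulr0 addr0.
by rewrite -sumrB mulr_sumr -big_split; apply: eq_bigr => i _; rewrite !mxE.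
Qed.

Lemma dotvZr (t : R) v x : dotv v (t *: x) = t * dotv v x.
Proof. by rewrite mulr_sumr; apply: eq_bigr => i _; rewrite mxE; ring. Qed.

Lemma dotvDr v x y : dotv v (x + y) = dotv v x + dotv v y.
Proof. by rewrite -big_split; apply: eq_bigr => i _; rewrite !mxE mulrDr. Qed.

Lemma dotvBr v x y : dotv v (x - y) = dotv v x - dotv v y.
Proof. by rewrite -scaleN1r dotvDr dotvZr mulN1r. Qed.

Section Gradient.
Variables (h : 'rV[R]_m -> R) (g : 'rV[R]_m -> 'rV[R]_m) (alpha : R).
Hypothesis h_convex : strictly_convex_on (relint (distr (k := m))) h.
Hypothesis h_grad : is_gradient (distr (k := m)) h g.
Hypothesis alpha_gt0 : 0 < alpha.

(** The gradient only controls [h] near [p], so the first-order expansion is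
    used at a point of the segment close to [p]. *)
Lemma gradient_segment p q (e : R) : 0 < e ->
  distr_ge alpha p -> distr_ge alpha q ->
  exists2 t : R, 0 < t < 1 &
    `|h (p + t *: (q - p)) - h p - t * dotv (g p) (q - p)| <= t * e.
Proof.
(* The summand [1] keeps [N] positive when [p = q]. *)
move=> e0 pa qa; set N := `|q - p| + 1.
have N0 : 0 < N by rewrite ltr_wpDl.
have := h_grad p (distr_ge_relint _ _ alpha_gt0 pa) (e / N) (divr_gt0 e0 N0).
move=> /nbhs_ballP[d /= d0 pd]; exists (Num.min (1 / 2) (d / 2 / N)).
  by rewrite lt_min !divr_gt0 // gt_min; apply/orP; left; lra.
set t := Num.min _ _.
have t0 : 0 < t by rewrite lt_min !divr_gt0.
have t1 : t <= 1 by rewrite ge_min; apply/orP; left; lra.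
have tN : t * `|q - p| < d.
  apply: (@le_lt_trans _ _ (t * N)); first by rewrite ler_wpM2l ?(ltW t0) // lerDl.
  apply: (@le_lt_trans _ _ (d / 2)); last by lra.
  by rewrite -ler_pdivlMr // ge_min lexx orbT.
have pt : p + t *: (q - p) - p = t *: (q - p) by rewrite addrAC subrr add0r.
have := pd (p + t *: (q - p)); rewrite pt dotvZr normrZ gtr0_norm //.
move=> /(_ _ _)/le_trans; apply.
- by rewrite -ball_normE /= -opprB pt normrN normrZ gtr0_norm.
- by have [] := distr_ge_conv alpha p q t _ pa qa; rewrite ?(ltW t0).
- rewrite mulrCA ler_wpM2l ?(ltW t0) // mulrAC ler_pdivrMr // ler_wpM2l ?(ltW e0) //.
  by rewrite lerDl.
Qed.

(** The chord lies above [h], and near [q] the graph of [h] is its tangent up to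
    a term [t * e] with [e] arbitrarily small. *)
Lemma bregman_ge0 p q : distr_ge alpha p -> distr_ge alpha q ->
  0 <= bregman h g p q.
Proof.
move=> pa qa; have [->|pq] := eqVneq p q.
  by rewrite /bregman subrr dotvBr !subrr.
rewrite /bregman subr_ge0; apply/ler_addgt0Pr => e e0.
have [t /andP[t0 t1]] := gradient_segment q p e e0 qa pa.
move=> /ler_normlP[+ _]; rewrite opprB lerBlDr => grad.
have := h_convex p q t (distr_ge_relint _ _ alpha_gt0 pa)
  (distr_ge_relint _ _ alpha_gt0 qa) pq.
rewrite t0 t1 => /(_ isT).
have -> : t *: p + (1 - t) *: q = q + t *: (p - q).
  by apply/matrixP => i j; rewrite !mxE; ring.
move=> conv; rewrite -(ler_pM2l t0); lra.
Qed.

(** The inequality is the first-order optimality condition at [x] along the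
    segment to [p], rewritten with the three-point identity of the
    divergence. *)
Lemma three_point (c : 'I_m -> R) (eta : R) p x y :
  argmax (distr_ge alpha (k := m))
    (fun p => eta * (\sum_a c a * p 0 a) - bregman h g p y) x ->
  distr_ge alpha p ->
  eta * (\sum_a c a * (p 0 a - x 0 a)) <=
    bregman h g p y - bregman h g p x - bregman h g x y.
Proof.
move=> [xa xmax] pa.
suff opt : eta * (\sum_a c a * (p 0 a - x 0 a)) <=
    dotv (g x) (p - x) - dotv (g y) (p - x).
  apply: le_trans opt _; rewrite /bregman !dotvBr; lra.
apply/ler_addgt0Pr => e e0.
have [t /andP[t0 t1]] := gradient_segment x p e e0 xa pa.
move=> /ler_normlP[_ +] => grad.
have /xmax : distr_ge alpha (x + t *: (p - x)).
  by apply: distr_ge_conv => //; rewrite !ltW.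
have -> : \sum_a c a * (x + t *: (p - x)) 0 a =
    \sum_a c a * x 0 a + t * (\sum_a c a * (p 0 a - x 0 a)).
  by rewrite mulr_sumr -big_split; apply: eq_bigr => a _; rewrite !mxE /=; ring.
have -> : bregman h g (x + t *: (p - x)) y =
    h (x + t *: (p - x)) - h y - (dotv (g y) (x - y) + t * dotv (g y) (p - x)).
  by rewrite /bregman -dotvZr -dotvDr [x - y + _]addrAC.
rewrite /bregman => opt; rewrite -(ler_pM2l t0); nra.
Qed.

End Gradient.
End Bregman.

(** * Convergence *)

Section MirrorAscent.
Context {R : realType} {n m : nat}.
Variables (M : mdp R n m) (h : 'rV[R]_m -> R) (g : 'rV[R]_m -> 'rV[R]_m).
Variables (alpha : R) (mu : 'rV[R]_n) (pi0 : 'M[R]_(n, m)).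
Variables (eta : nat -> R) (pi : nat -> 'M[R]_(n, m)).
Hypothesis h_convex : strictly_convex_on (relint (distr (k := m))) h.
Hypothesis h_grad : is_gradient (distr (k := m)) h g.
Hypothesis alpha_gt0 : 0 < alpha.
Hypothesis mu_pos : distr_pos mu.
Hypothesis pi0_ge : policy_ge alpha pi0.
Hypothesis eta_gt0 : forall k, 0 < eta k.
Hypothesis Calpha_gt0 : 0 < Calpha M alpha mu.
Hypothesis ascent : clipped_mirror_ascent M h g alpha eta pi0 pi.

Lemma row_policy_ge (p : 'M[R]_(n, m)) :
  policy_ge alpha p <-> forall s, distr_ge alpha (row s p).
Proof.
split=> [[pp pa] s|pa]; first by split=> // a; rewrite mxE.
by split=> [s|s a]; have [pd ge] := pa s => //; have := ge a; rewrite mxE.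
Qed.

Lemma iterate_ge k : policy_ge alpha (pi k).
Proof.
case: k => [|k]; first by rewrite ascent.1.
by apply/row_policy_ge => s; have [] := ascent.2 k s.
Qed.

Lemma iterate_three_point k s (p : 'M[R]_(n, m)) : policy_ge alpha p ->
  eta k * (\sum_a G M (pi k) s a * (p s a - pi k.+1 s a)) <=
    bregman h g (row s p) (row s (pi k)) - bregman h g (row s p) (row s (pi k.+1))
    - bregman h g (row s (pi k.+1)) (row s (pi k)).
Proof.
move=> /row_policy_ge/(_ s) pa.
have := three_point _ _ _ h_grad alpha_gt0 _ _ _ _ _ (ascent.2 k s) pa.
by under eq_bigr => a _ do rewrite [row s p 0 a]mxE [row s (pi k.+1) 0 a]mxE.
Qed.

Lemma iterate_bregman_ge0 s (p q : 'M[R]_(n, m)) :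
  policy_ge alpha p -> policy_ge alpha q ->
  0 <= bregman h g (row s p) (row s q).
Proof.
move=> /row_policy_ge/(_ s) pa /row_policy_ge/(_ s) qa.
exact: (bregman_ge0 _ _ _ h_convex h_grad alpha_gt0).
Qed.

(** The comparator [pi k] makes the left-hand side of [iterate_three_point] minus
    [eta k] times the improvement, and the right-hand side nonpositive. *)
Lemma iterate_improves k s :
  0 <= \sum_a G M (pi k) s a * (pi k.+1 s a - pi k s a).
Proof.
have := iterate_three_point k s _ (iterate_ge k).
have := iterate_bregman_ge0 s _ _ (iterate_ge k) (iterate_ge k.+1).
have := iterate_bregman_ge0 s _ _ (iterate_ge k.+1) (iterate_ge k).
have -> : bregman h g (row s (pi k)) (row s (pi k)) = 0.
  by rewrite /bregman subrr dotvBr !subrr.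
have -> : \sum_a G M (pi k) s a * (pi k s a - pi k.+1 s a) =
    - \sum_a G M (pi k) s a * (pi k.+1 s a - pi k s a).
  by rewrite -sumrN; apply: eq_bigr => a _; ring.
move=> D1 D2; rewrite mulrN => D3.
by rewrite -(pmulr_rge0 _ (eta_gt0 k)); lra.
Qed.

(** Summed with the weights [rho p], the inequality [iterate_three_point] at
    the comparator [p] bounds [Jmu p - Jmu (pi k)] by the decrease of the
    divergence plus the improvement of [pi k.+1] weighted by [rho p].  Each
    state improves, so [rho p <= Calpha * rho (pi k.+1)] turns the latter into
    [Calpha] times the true gain [Jmu (pi k.+1) - Jmu (pi k)]. *)
Lemma ascent_step k (p : 'M[R]_(n, m)) : policy_ge alpha p ->
  eta k * (Jmu M mu p - Jmu M mu (pi k))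
    + bregman_weighted h g (rho M mu p) p (pi k.+1) <=
  eta k * (Calpha M alpha mu * (Jmu M mu (pi k.+1) - Jmu M mu (pi k)))
    + bregman_weighted h g (rho M mu p) p (pi k).
Proof.
move=> pa; have pos (q : 'M[R]_(n, m)) : policy_ge alpha q -> policy_pos q.
  exact: policy_ge_pos.
rewrite (performance_difference _ _ _ (pos _ (iterate_ge k)) (pos _ pa)).
rewrite (performance_difference _ _ _ (pos _ (iterate_ge k)) (pos _ (iterate_ge k.+1))).
rewrite /bregman_weighted !mulr_sumr -!big_split /=; apply: ler_sum => s _.
have rho0 : 0 < rho M mu p 0 s by exact: rho_gt0 (pos _ pa).
have := rho_le_Calpha M alpha mu p (pi k.+1) s alpha_gt0 mu_pos Calpha_gt0 pa
  (iterate_ge k.+1).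
have := iterate_improves k s.
have := iterate_three_point k s p pa.
have := iterate_bregman_ge0 s _ _ (iterate_ge k.+1) (iterate_ge k).
have -> : \sum_a G M (pi k) s a * (p s a - pi k.+1 s a) =
    \sum_a G M (pi k) s a * (p s a - pi k s a) -
    \sum_a G M (pi k) s a * (pi k.+1 s a - pi k s a).
  by rewrite -sumrB; apply: eq_bigr => a _; ring.
set A := \sum_a _ * (p s a - pi k s a).
set B := \sum_a _ * (pi k.+1 s a - pi k s a).
set D1 := bregman _ _ (row s p) (row s (pi k.+1)).
set D2 := bregman _ _ (row s p) (row s (pi k)) => D0 tp B0 rC.
have tp' : eta k * A + D1 <= eta k * B + D2 by lra.
have := ler_wpM2l (ltW rho0) tp'.
have := ler_wpM2l (mulr_ge0 (ltW (eta_gt0 k)) B0) rC.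
lra.
Qed.

End MirrorAscent.

Theorem theorem10 (R : realType) (n m : nat) (M : mdp R n m)
    (h : 'rV[R]_m -> R) (gradh : 'rV[R]_m -> 'rV[R]_m)
    (alpha : R) (mu : 'rV[R]_n) (pi0 pi_alpha : 'M[R]_(n, m))
    (eta : nat -> R) (pi : nat -> 'M[R]_(n, m)) :
  strictly_convex_on (relint (distr (k := m))) h ->
  C1_on_relint (distr (k := m)) h gradh ->
  0 < alpha < m%:R^-1 ->
  distr_pos mu ->
  policy_ge alpha pi0 ->
  (forall k : nat,
     (Calpha M alpha mu - 1) * eta k.+1 >= Calpha M alpha mu * eta k /\
     Calpha M alpha mu * eta k > 0 /\ eta k > 0) ->
  clipped_mirror_ascent M h gradh alpha eta pi0 pi ->
  argmax (policy_ge alpha) (Jmu M mu) pi_alpha ->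
  forall k : nat,
    Jmu M mu pi_alpha - Jmu M mu (pi k) <=
      (1 - (Calpha M alpha mu)^-1) ^+ k *
      (bregman_weighted h gradh (rho M mu pi_alpha) pi_alpha pi0
         / (eta 0%N * (Calpha M alpha mu - 1))
       + (Jmu M mu pi_alpha - Jmu M mu pi0)).
Proof.
move=> h_convex [h_grad _] /andP[a0 _] mup pi0a step ascent [paa _] k.
set C := Calpha M alpha mu in step *.
have eta0 j : 0 < eta j by have [_ []] := step j.
have C0 : 0 < C by have [_ []] := step 0%N; rewrite pmulr_lgt0.
have C1 : 0 < C - 1.
  have [le_eta [Ceta _]] := step 0%N.
  by rewrite -(pmulr_lgt0 _ (eta0 1%N)) (lt_le_trans Ceta).
pose B j := bregman_weighted h gradh (rho M mu pi_alpha) pi_alpha (pi j).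
pose d j := Jmu M mu pi_alpha - Jmu M mu (pi j).
have ge_pi := iterate_ge M h gradh alpha pi0 eta pi pi0a ascent.
have B0 j : 0 <= B j.
  apply: sumr_ge0 => s _; apply: mulr_ge0.
    by apply: ltW; apply: rho_gt0 => //; exact: policy_ge_pos paa.
  exact: (iterate_bregman_ge0 _ _ _ h_convex h_grad a0).
(* [ascent_step] leaves [B j.+1] divided by [C * eta j], which the growth of
   the step sizes makes at most [eta j.+1 * (C - 1)]. *)
have contract j : d j.+1 + B j.+1 / (eta j.+1 * (C - 1)) <=
    (1 - C^-1) * (d j + B j / (eta j * (C - 1))).
  have := ascent_step M h gradh alpha mu pi0 eta pi h_convex h_grad a0 mup
    pi0a eta0 C0 ascent j pi_alpha paa.
  rewrite -/(B j) -/(B j.+1) -/(d j) -/C.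
  have -> : Jmu M mu (pi j.+1) - Jmu M mu (pi j) = d j - d j.+1.
    by rewrite /d; ring.
  move=> stepj; apply: (@le_trans _ _ (d j.+1 + B j.+1 / (C * eta j))).
    rewrite lerD2l ler_wpM2l // lef_pV2 ?posrE ?mulr_gt0 //.
    by rewrite [leRHS]mulrC; have [] := step j.
  rewrite -(ler_pM2l (mulr_gt0 C0 (eta0 j))).
  have -> : C * eta j * (d j.+1 + B j.+1 / (C * eta j)) =
      eta j * C * d j.+1 + B j.+1.
    by field; rewrite !gt_eqF.
  have -> : C * eta j * ((1 - C^-1) * (d j + B j / (eta j * (C - 1)))) =
      eta j * (C - 1) * d j + B j.
    by field; rewrite !gt_eqF.
  lra.
have decay j : d j + B j / (eta j * (C - 1)) <=
    (1 - C^-1) ^+ j * (d 0%N + B 0%N / (eta 0%N * (C - 1))).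
  elim: j => [|j IHj]; first by rewrite expr0 mul1r.
  apply: le_trans (contract j) _; rewrite exprS -mulrA ler_wpM2l //.
  by rewrite subr_ge0 invf_le1 // -subr_ge0 ltW.
rewrite -ascent.1 [X in _ * X]addrC; apply: le_trans _ (decay k).
by rewrite lerDl divr_ge0 // mulr_ge0 // ltW.
Qed.
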